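(* Let $P=(P_0,\dots,P_{2n-1})$ be a CPPOS and $p\in\operatorname{int}(P)$. Suppose that a cell of the pencil through $p$ is supported on the opposite sides $e_i$ and $e_{i+n}$. Then $D_i=(1-\lambda_i)P_i+\lambda_iP_{i+n}$. Let $\tau_i:\mathbb{R}^2\to\mathbb{R}$ be the affine function equal to $0$ on the line containing $e_i$ and to $1$ on the line containing $e_{i+n}$. Then all reflected lines belonging to this cell pass through the single point $$Q_i(p)=D_i-\frac{\mu_i}{1+(\mu_i^2-1)\tau_i(p)}(p-D_i).$$ Equivalently, $$Q_i(p)=D_i-\frac{\lambda_i(1-\lambda_i)}{\lambda_i^2+(1-2\lambda_i)\tau_i(p)}(p-D_i).$$ Thus the corresponding conic piece of $\operatorname{ART}_P(p)$ degenerates to the point $Q_i(p)$. The map $R_i:p\mapsto Q_i(p)$ extends to a projective involution of $\mathbb{RP}^2$. Every projective line through $D_i$ is invariant under $R_i$. For $p\in\operatorname{int}(P)$, the point $D_i$ lies between $p$ and $Q_i(p)$.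
   Context: A CPPOS (convex polygon with parallel opposite sides) is a positively oriented convex polygon $P=(P_0,\dots,P_{2n-1})$, indices modulo $2n$, all $P_i$ genuine vertices (consecutive edge vectors linearly independent), whose edge vectors $e_i=P_{i+1}-P_i$ satisfy $e_{i+n}=-\mu_ie_i$ with $\mu_i>0$. Put $\lambda_i=\frac1{1+\mu_i}$. $P$ also denotes the closed convex region it bounds. The great diagonals are $d_i=\overline{P_iP_{i+n}}$ and $D_i=d_i\cap d_{i+1}$. Boundary involution: $\sigma_P:\partial P\to\partial P$, $\sigma_P(P_i+s e_i)=P_{i+n}+s e_{i+n}$, $0\le s\le1$. For a line $\ell$ meeting $\operatorname{int}(P)$ with boundary intersection points $x_\ell,y_\ell$, the reflected line is $\Phi_P(\ell)=\overline{\sigma_P(x_\ell)\sigma_P(y_\ell)}$. $\Lambda_p$ is the pencil of lines through $p$. The cell supported on $e_i$ and $e_j$ is the open arc of lines of $\Lambda_p$ whose two boundary intersection points lie in the open sides $e_i=(P_i,P_{i+1})$ and $e_j=(P_j,P_{j+1})$. The piece of $\operatorname{ART}_P(p)$ (affine reflection transform) corresponding to a cell is the envelope of the reflected lines of that cell (with homogeneous line coordinates $\boldsymbol\ell(s)$, the envelope point is $[\boldsymbol\ell\times\boldsymbol\ell']$); it is always a conic arc or a degeneration of one. *)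

(* Defs.v *)
From HB Require Import structures.
From mathcomp Require Import all_boot all_order all_algebra.
From mathcomp Require Import all_classical all_reals all_analysis.
Set Implicit Arguments.
Unset Strict Implicit.
Unset Printing Implicit Defensive.
Import Order.TTheory GRing.Theory Num.Theory.
Import numFieldNormedType.Exports.
Local Open Scope classical_set_scope.
Local Open Scope ring_scope.

Definition det2 (R : realType) (u v : 'rV[R]_2) : R :=
  u 0 0 * v 0 1 - u 0 1 * v 0 0.

Definition line_through (R : realType) (x y : 'rV[R]_2) : set 'rV[R]_2 :=
  [set x + t *: (y - x) | t in [set: R]].

Definition is_line (R : realType) (L : set 'rV[R]_2) : Prop :=
  exists x y : 'rV[R]_2, x != y /\ L = line_through x y.

Definition is_affine (R : realType) (f : 'rV[R]_2 -> R) : Prop :=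
  exists (g : {scalar 'rV[R]_2}) (c : R), forall q, f q = g q + c.

(** ** Polygons with parallel opposite sides *)

(* Vertices are indexed by Z/2n; [n%:R] is the index shift by n. *)
Definition edge (R : realType) (n : nat) (P : 'Z_(2 * n) -> 'rV[R]_2)
    (k : 'Z_(2 * n)) : 'rV[R]_2 :=
  P (k + 1) - P k.

(* Convexity and positive orientation: every edge has all the other vertices
   strictly on its left.  Strictness forces the polygon to be traversed once. *)
Record cppos (R : realType) (n : nat) (P : 'Z_(2 * n) -> 'rV[R]_2)
    (mu : 'Z_(2 * n) -> R) : Prop := Cppos {
  cppos_size : (1 < n)%N ;
  cppos_convex : forall k j : 'Z_(2 * n), j != k -> j != k + 1 ->
    0 < det2 (edge P k) (P j - P k) ;
  cppos_genuine : forall k : 'Z_(2 * n),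
    free [:: edge P k; edge P (k + 1)] ;
  cppos_mu_gt0 : forall k : 'Z_(2 * n), 0 < mu k ;
  cppos_parallel : forall k : 'Z_(2 * n),
    edge P (k + n%:R) = - mu k *: edge P k }.

Definition lam (R : realType) (n : nat) (mu : 'Z_(2 * n) -> R)
    (k : 'Z_(2 * n)) : R :=
  1 / (1 + mu k).

(* The closed region bounded by P, as the convex hull of the vertices. *)
Definition region (R : realType) (n : nat) (P : 'Z_(2 * n) -> 'rV[R]_2) :
    set 'rV[R]_2 :=
  [set q | exists w : 'Z_(2 * n) -> R,
     [/\ forall k, 0 <= w k, \sum_k w k = 1 & q = \sum_k w k *: P k]].

Definition side (R : realType) (n : nat) (P : 'Z_(2 * n) -> 'rV[R]_2)
    (k : 'Z_(2 * n)) : set 'rV[R]_2 :=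
  [set P k + s *: edge P k | s in `[0, 1]].

Definition open_side (R : realType) (n : nat) (P : 'Z_(2 * n) -> 'rV[R]_2)
    (k : 'Z_(2 * n)) : set 'rV[R]_2 :=
  [set P k + s *: edge P k | s in `]0, 1[].

Definition bdry (R : realType) (n : nat) (P : 'Z_(2 * n) -> 'rV[R]_2) :
    set 'rV[R]_2 :=
  \bigcup_k side P k.

Definition great_diag (R : realType) (n : nat) (P : 'Z_(2 * n) -> 'rV[R]_2)
    (k : 'Z_(2 * n)) : set 'rV[R]_2 :=
  [set P k + s *: (P (k + n%:R) - P k) | s in `[0, 1]].

Definition Dpt (R : realType) (n : nat) (P : 'Z_(2 * n) -> 'rV[R]_2)
    (k : 'Z_(2 * n)) : 'rV[R]_2 :=
  get (great_diag P k `&` great_diag P (k + 1)).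

(** ** Reflected lines *)

(* The point described by [get] is unique when q lies on the boundary: the two
   descriptions of a vertex give the same opposite vertex. *)
Definition sigma (R : realType) (n : nat) (P : 'Z_(2 * n) -> 'rV[R]_2)
    (q : 'rV[R]_2) : 'rV[R]_2 :=
  get [set q' | exists (k : 'Z_(2 * n)) (s : R),
    [/\ 0 <= s <= 1, q = P k + s *: edge P k
      & q' = P (k + n%:R) + s *: edge P (k + n%:R)]].

(* The line through sigma x and sigma y, where L meets the boundary of P in
   {x, y}; no choice is involved, as [line_through] is symmetric. *)
Definition reflected (R : realType) (n : nat) (P : 'Z_(2 * n) -> 'rV[R]_2)
    (L : set 'rV[R]_2) : set 'rV[R]_2 :=
  [set q | exists x y : 'rV[R]_2,
    [/\ x != y, L `&` bdry P = [set x; y]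
      & line_through (sigma P x) (sigma P y) q]].

Definition pencil (R : realType) (p : 'rV[R]_2) : set (set 'rV[R]_2) :=
  [set L | is_line L /\ L p].

Definition cell (R : realType) (n : nat) (P : 'Z_(2 * n) -> 'rV[R]_2)
    (p : 'rV[R]_2) (i j : 'Z_(2 * n)) : set (set 'rV[R]_2) :=
  [set L | pencil p L /\ exists x y : 'rV[R]_2,
    [/\ x != y, L `&` bdry P = [set x; y], open_side P i x
      & open_side P j y]].

(** ** Projective plane, envelopes *)

(* Points (resp. lines) of the real projective plane are the subspaces of R^3
   of dimension 1 (resp. 2). *)
Definition hcoords (R : realType) (q : 'rV[R]_2) : 'rV[R]_3 :=
  \row_(k < 3) [:: q 0 0; q 0 1; 1]`_k.

Definition proj_pt (R : realType) (q : 'rV[R]_2) : {vspace 'rV[R]_3} :=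
  <[hcoords q]>%VS.

Definition cross (R : realType) (u v : 'rV[R]_3) : 'rV[R]_3 :=
  \row_(k < 3) [:: u 0 1 * v 0 2%:R - u 0 2%:R * v 0 1;
                   u 0 2%:R * v 0 0 - u 0 0 * v 0 2%:R;
                   u 0 0 * v 0 1 - u 0 1 * v 0 0]`_k.

Definition line_coords (R : realType) (L : set 'rV[R]_2) (l : 'rV[R]_3) :
    Prop :=
  l != 0 /\ L = [set q | l *m (hcoords q)^T = 0].

(* The projective points [l(s) x l'(s)], for l a differentiable local family of
   homogeneous coordinates of lines of F, at the s where this vector is
   nonzero. *)
Definition envelope (R : realType) (F : set (set 'rV[R]_2)) :
    set {vspace 'rV[R]_3} :=
  [set Z | exists (l : R -> 'rV[R]_3) (s : R),
    [/\ \forall u \near s,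
          derivable l u 1 /\ (exists2 L, F L & line_coords L (l u)),
        cross (l s) (derive1 l s) != 0
      & Z = <[cross (l s) (derive1 l s)]>%VS]].

Definition art_piece (R : realType) (n : nat) (P : 'Z_(2 * n) -> 'rV[R]_2)
    (p : 'rV[R]_2) (i j : 'Z_(2 * n)) : set {vspace 'rV[R]_3} :=
  envelope [set reflected P L | L in cell P p i j].

(* The map U |-> f @: U induced by f on projective points is an involutive
   projective transformation, different from the identity. *)
Definition projective_involution (R : realType) (f : 'End('rV[R]_3)) : Prop :=
  [/\ lker f = 0%VS,
      forall U : {vspace 'rV[R]_3}, \dim U = 1%N -> (f @: (f @: U))%VS = U
    & exists2 U : {vspace 'rV[R]_3}, \dim U = 1%N & (f @: U)%VS <> U].

(** ** The point Q_i(p) *)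

Definition is_tau (R : realType) (n : nat) (P : 'Z_(2 * n) -> 'rV[R]_2)
    (i : 'Z_(2 * n)) (f : 'rV[R]_2 -> R) : Prop :=
  [/\ is_affine f,
      forall q, line_through (P i) (P (i + 1)) q -> f q = 0
    & forall q, line_through (P (i + n%:R)) (P (i + n%:R + 1)) q -> f q = 1].

Definition tau (R : realType) (n : nat) (P : 'Z_(2 * n) -> 'rV[R]_2)
    (i : 'Z_(2 * n)) : 'rV[R]_2 -> R :=
  get [set f | is_tau P i f].

Definition Qpt (R : realType) (n : nat) (P : 'Z_(2 * n) -> 'rV[R]_2)
    (mu : 'Z_(2 * n) -> R) (i : 'Z_(2 * n)) (p : 'rV[R]_2) : 'rV[R]_2 :=
  Dpt P i - (mu i / (1 + (mu i ^+ 2 - 1) * tau P i p)) *: (p - Dpt P i).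

(* Main.v *)
Require Import Defs.
From HB Require Import structures.
From mathcomp Require Import all_boot all_order all_algebra ring lra zify.
From mathcomp Require Import all_classical all_reals all_analysis.
Import Order.TTheory GRing.Theory Num.Theory.
Import numFieldNormedType.Exports.
Local Open Scope classical_set_scope.
Local Open Scope ring_scope.

(** Write [e = edge P i], [A = P i], [B = P (i + n)], [m = mu i]. The vectors
[e] and [B - A] form a frame of the plane, in which [tau P i] is the
coordinate along [B - A] and [D = A + (B - A) / (1 + m)].

The homothety of centre [D] and ratio [- m] carries the side [e_i] onto the
parallel side [e_(i+n)] and agrees there with the boundary involution; its
inverse agrees with the involution on [e_(i+n)]. A line of the cell meets the
sides at [x] and [y] with [p = (1 - r) x + r y], where [r = tau P i p] is the
same for all lines of the cell. Measured from [D], the reflected line joins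
[- m x] to [- y / m]. The affine combination of these two points with weights
proportional to [(1 - r) / m] and [m r] is a multiple of [p] that depends on
[r] only: this is the point [Q p], common to all reflected lines
([reflected_chord_Q]).

A family of lines through a fixed point has that point as its envelope: their
coordinates, and hence the derivatives of these, are orthogonal to the point
([envelope_sub]). Conversely the reflected lines near a given one are those
joining [Q p] to [A + t e] for [t] in an interval, and their coordinates
are affine in [t], so the point is attained ([envelope_sup]). That every such
line comes from the cell rests on convexity: a chord between two different
open sides meets the boundary at its ends only ([chord_bdry]).

In homogeneous coordinates [Q] is [v |-> phi v *: D - m *: v] for a linear
form [phi] with [phi D = 2 m]. Such a map squares to [m ^ 2] and preserves
all subspaces through [D]: it is a harmonic homology of centre [D]
([Q_homology]). In the interior of the polygon [0 < tau P i < 1]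
([tau_interior]), so that the factor of [p - D] in [Q p - D] is a
well-defined negative number, and [D] lies between [p] and [Q p]. *)

(** * Plane geometry *)

Lemma row2P (R : realType) (u v : 'rV[R]_2) :
  u 0 0 = v 0 0 -> u 0 1 = v 0 1 -> u = v.
Proof.
move=> e0 e1; apply/rowP; case=> [[|[|//]]] lt2.
- by rewrite (_ : Ordinal lt2 = 0) //; apply: val_inj.
- by rewrite (_ : Ordinal lt2 = 1) //; apply: val_inj.
Qed.

Lemma det2_is_scalar (R : realType) (u : 'rV[R]_2) : scalar (det2 u).
Proof. by move=> a x y; rewrite /det2 !mxE; ring. Qed.

HB.instance Definition _ (R : realType) (u : 'rV[R]_2) :=
  GRing.isLinear.Build R 'rV[R]_2 R *%R (det2 u) (det2_is_scalar R u).

Lemma det2_combo (R : realType) (u v a b : 'rV[R]_2) (s : R) :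
  det2 u (a + s *: (b - a) - v) =
  (1 - s) * det2 u (a - v) + s * det2 u (b - v).
Proof. rewrite /det2 !mxE; ring. Qed.

(** Cramer's rule: [det2 u v != 0] makes [(u, v)] a coordinate frame. *)
Lemma frame_coords (R : realType) (u v a q : 'rV[R]_2) :
  det2 u v != 0 ->
  q = a + (det2 (q - a) v / det2 u v) *: u + (det2 u (q - a) / det2 u v) *: v.
Proof.
by move=> uv0; apply: row2P; rewrite !mxE /det2 !mxE; field; move: uv0; rewrite /det2.
Qed.

Lemma line_throughE (R : realType) (x y : 'rV[R]_2) : x != y ->
  line_through x y = [set q | det2 (y - x) (q - x) = 0].
Proof.
move=> xy; apply/seteqP; split=> [q [t _ <-]|q /= det0].
  by rewrite /= /det2 !mxE; ring.
have [d0|d0] := eqVneq ((y - x) 0 0) 0.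
  have d1 : (y - x) 0 1 != 0.
    apply: contra xy => /eqP d1; rewrite eq_sym -subr_eq0; apply/eqP.
    by apply: row2P; rewrite ?d0 ?d1 mxE.
  exists ((q - x) 0 1 / (y - x) 0 1) => //.
  move: d0 d1 det0; rewrite /det2 !mxE => d0 d1.
  rewrite d0 mul0r sub0r => /eqP; rewrite oppr_eq0 mulf_eq0 (negPf d1) /= => /eqP q0.
  by apply: row2P; rewrite !mxE; [rewrite d0 mulr0; lra|field].
exists ((q - x) 0 0 / (y - x) 0 0) => //.
move: d0 det0; rewrite /det2 !mxE => d0 /subr0_eq det0.
apply: row2P; rewrite !mxE; first by field.
by apply: (mulfI d0); rewrite mulrDr mulrCA mulrA divfK // mulrC -?det0; lra.
Qed.

Lemma line_through_sym (R : realType) (x y : 'rV[R]_2) :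
  line_through x y = line_through y x.
Proof.
have sub (a b : 'rV[R]_2) : line_through a b `<=` line_through b a.
  by move=> q [t _ <-]; exists (1 - t) => //; apply: row2P; rewrite !mxE; ring.
by apply/seteqP; split; apply: sub.
Qed.

Lemma is_line_through (R : realType) (L : set 'rV[R]_2) (x y : 'rV[R]_2) :
  is_line L -> L x -> L y -> x != y -> L = line_through x y.
Proof.
move=> [a [b [ab ->]]] [s _ <-] [t _ <-] xy.
have st : t - s != 0.
  by apply: contra xy => /eqP/subr0_eq ->.
apply/seteqP; split=> [q [u _ <-]|q [u _ <-]].
  exists ((u - s) / (t - s)) => //.
  by apply: row2P; rewrite !mxE; field.
by exists (s + u * (t - s)) => //; apply: row2P; rewrite !mxE; ring.
Qed.

(** * Homogeneous coordinates and envelopes *)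

Lemma row3P (R : realType) (u v : 'rV[R]_3) :
  u 0 0 = v 0 0 -> u 0 1 = v 0 1 -> u 0 2%:R = v 0 2%:R -> u = v.
Proof.
move=> e0 e1 e2; apply/rowP; case=> [[|[|[|//]]]] lt3.
- by rewrite (_ : Ordinal lt3 = 0) //; apply: val_inj.
- by rewrite (_ : Ordinal lt3 = 1) //; apply: val_inj.
- by rewrite (_ : Ordinal lt3 = 2%:R) //; apply: val_inj.
Qed.

Lemma dot3E (R : realType) (u : 'rV[R]_3) (v : 'cV[R]_3) :
  (u *m v) 0 0 = u 0 0 * v 0 0 + u 0 1 * v 1 0 + u 0 2%:R * v 2%:R 0.
Proof.
rewrite mxE 3!big_ord_recl big_ord0 addr0 addrA.
by congr (_ * _ + _ * _ + _ * _); congr (_ _ _); apply: val_inj.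
Qed.

Lemma hcoordsE (R : realType) (q : 'rV[R]_2) :
  (hcoords q 0 0 = q 0 0) * (hcoords q 0 1 = q 0 1) * (hcoords q 0 2%:R = 1).
Proof. by rewrite /hcoords !mxE. Qed.

Lemma crossE (R : realType) (u v : 'rV[R]_3) :
  (cross u v 0 0 = u 0 1 * v 0 2%:R - u 0 2%:R * v 0 1) *
  (cross u v 0 1 = u 0 2%:R * v 0 0 - u 0 0 * v 0 2%:R) *
  (cross u v 0 2%:R = u 0 0 * v 0 1 - u 0 1 * v 0 0).
Proof. by rewrite /cross !mxE. Qed.

Lemma hcoords_neq0 (R : realType) (q : 'rV[R]_2) : hcoords q != 0.
Proof.
apply/eqP => /(congr1 (fun v : 'rV[R]_3 => v 0 2%:R)).
by rewrite hcoordsE mxE => /eqP; rewrite oner_eq0.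
Qed.

Lemma hcoords_scale_inj (R : realType) (k : R) (a b : 'rV[R]_2) :
  hcoords a = k *: hcoords b -> a = b.
Proof.
have E j : (k *: hcoords b) 0 j = k * hcoords b 0 j by rewrite !mxE.
move=> ab; have ab_at j := congr1 (fun v : 'rV[R]_3 => v 0 j) ab.
have := ab_at 2%:R; rewrite E !hcoordsE mulr1 => k1.
have := ab_at 1; have := ab_at 0; rewrite !E -k1 !hcoordsE !mul1r.
exact: row2P.
Qed.

Lemma hcoords_affine (R : realType) (a v : 'rV[R]_2) (t : R) :
  hcoords (a + t *: v) = hcoords a + t *: (hcoords (a + v) - hcoords a).
Proof. by apply: row3P; rewrite /hcoords !mxE /= ?mxE; ring. Qed.

Lemma cross_affine (R : realType) (a b c : 'rV[R]_3) (t : R) :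
  cross a b + t *: cross a c = cross a (b + t *: c).
Proof. by apply: row3P; rewrite /cross !mxE /= ?mxE; ring. Qed.

(** The lines [a b] and [a c] meet in [a]; the factor is the triple product of
[a], [b] and [c]. *)
Lemma cross_cross (R : realType) (a b c : 'rV[R]_3) :
  cross (cross a b) (cross a c) = (a *m (cross b c)^T) 0 0 *: a.
Proof.
apply: row3P; rewrite dot3E [RHS]mxE !crossE ![_^T _ _]mxE !crossE; ring.
Qed.

Lemma mx11_eq0 (R : realType) (M : 'M[R]_1) : (M == 0) = (M 0 0 == 0).
Proof.
apply/eqP/eqP => [->|M0]; first by rewrite mxE.
by apply/matrixP => a b; rewrite !ord1 M0 mxE.
Qed.

(** Both sides are the determinant of the homogeneous coordinates of [a], [b] and
[q], up to sign. *)
Lemma cross_incidence (R : realType) (a b q : 'rV[R]_2) :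
  (cross (hcoords a) (hcoords b) *m (hcoords q)^T == 0) =
  (det2 (b - a) (q - a) == 0).
Proof.
rewrite mx11_eq0 dot3E !crossE ![_^T _ _]mxE !hcoordsE /det2 !mxE.
by congr (_ == _); ring.
Qed.

(** Projective uniqueness of the intersection point: two distinct lines share
only one point, and the cross product computes it. *)
Lemma cross_concurrent (R : realType) (u v : 'rV[R]_3) (q : 'rV[R]_2) :
  u *m (hcoords q)^T = 0 -> v *m (hcoords q)^T = 0 -> cross u v != 0 ->
  <[cross u v]>%VS = proj_pt q.
Proof.
move=> /eqP + /eqP; rewrite !mx11_eq0 !dot3E ![_^T _ _]mxE !hcoordsE.
move=> /eqP uq /eqP vq uv0.
have cE : cross u v = cross u v 0 2%:R *: hcoords q.
  by apply: row3P; rewrite [RHS]mxE !hcoordsE !crossE; nra.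
have c0 : cross u v 0 2%:R != 0.
  by apply: contra uv0 => /eqP c0; rewrite cE c0 scale0r.
rewrite cE /proj_pt; apply/eqP; rewrite eqEsubv -!memvE memvZ ?memv_line //=.
by rewrite -{1}[hcoords q](scalerK c0) memvZ // memv_line.
Qed.

(** A fixed linear equation passes to the derivative; here it says that the
lines go through a fixed point. *)
Lemma derive1_mulmx0 (R : realType) (l : R -> 'rV[R]_3) (s : R)
    (c : 'cV[R]_3) :
  derivable l s 1 -> (\forall u \near s, l u *m c = 0) ->
  derive1 l s *m c = 0.
Proof.
move=> dl lc; apply/eqP; rewrite mx11_eq0 derive1E.
pose g (k : 'I_3) (u : R) := l u 0 k.
have gd k : is_derive s 1 (g k) ('D_1 (g k) s).
  by apply: DeriveDef => //; apply: (derivable_mxP _ _ _).1 dl 0 k.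
have sum_d := is_deriveD (is_deriveD (is_deriveZ (c 0 0) (gd 0))
  (is_deriveZ (c 1 0) (gd 1))) (is_deriveZ (c 2%:R 0) (gd 2%:R)).
have sum0 := @near_eq_is_derive _ _ _ _ (cst (0 : R)) _ _ _ _ sum_d.
have /sum0 d0 : \near s,
    (c 0 0 \*: g 0 + c 1 0 \*: g 1 + c 2%:R 0 \*: g 2%:R) s = cst (0 : R) s.
  near=> u; rewrite /cst; have : l u *m c = 0 by near: u.
  move=> /(congr1 (fun M : 'M[R]_1 => M 0 0)); rewrite dot3E mxE => <-.
  by rewrite ![_ * c _ _]mulrC.
have := derive_val (is_derive := d0); rewrite derive_cst => d0E.
rewrite dot3E derive_mx // !mxE [eqbRHS]d0E.
by rewrite ![_ * c _ _]mulrC.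
Unshelve. all: by end_near. Qed.

Lemma is_derive_affine (R : realType) (V : normedModType R) (a b : V) (t : R) :
  is_derive t (1 : R) (fun u : R => a + u *: b) b.
Proof.
have tb : is_derive t (1 : R) (fun u : R => u *: b) b.
  have [d dE] := is_diff_scalel t b.
  by apply: DeriveDef; [exact: diff_derivable|rewrite deriveE // dE scale1r].
by have := is_deriveD (is_derive_cst a t (1 : R)) tb; rewrite add0r.
Qed.

(** * Harmonic homologies *)

Definition col3 (R : realType) (a b c : R) : 'cV[R]_3 :=
  \col_(k < 3) [:: a; b; c]`_k.

Lemma dot_col3 (R : realType) (v : 'rV[R]_3) (a b c : R) :
  (v *m col3 R a b c) 0 0 = v 0 0 * a + v 0 1 * b + v 0 2%:R * c.
Proof. by rewrite dot3E /col3 !mxE. Qed.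

(** When [(d *m c) 0 0 = 2 m], this is the harmonic homology with centre [d]
and axis the line [v *m c = 0]: it is multiplication by [m] on [d] and by
[- m] on the axis. *)
Definition homology (R : realType) (m : R) (c : 'cV[R]_3) (d : 'rV[R]_3) :
    'End('rV[R]_3) :=
  linfun (mulmxr (c *m d - m%:M)).

Lemma homologyE (R : realType) (m : R) (c : 'cV[R]_3) (d v : 'rV[R]_3) :
  homology R m c d v = (v *m c) 0 0 *: d - m *: v.
Proof.
rewrite lfunE /= mulmxBr mulmxA [in LHS](mx11_scalar (v *m c)).
by rewrite mul_scalar_mx mul_mx_scalar.
Qed.

Section Homology.
Context (R : realType) (m : R) (c : 'cV[R]_3) (d : 'rV[R]_3).
Hypotheses (m0 : m != 0) (dc : (d *m c) 0 0 = m + m).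

Let f := homology R m c d.

Lemma homologyZ (a : R) (v : 'rV[R]_3) : f (a *: v) = a *: f v.
Proof. exact: linearZ. Qed.

Lemma homology_sq (v : 'rV[R]_3) : f (f v) = m ^+ 2 *: v.
Proof.
have formB (a b : R) (x y : 'rV[R]_3) :
    ((a *: x - b *: y) *m c) 0 0 = a * (x *m c) 0 0 - b * (y *m c) 0 0.
  by rewrite mulmxBl -!scalemxAl !mxE.
rewrite /f !homologyE formB dc scalerBr !scalerA opprB addrA addrAC.
by rewrite -scalerBl (_ : _ - _ - _ = 0) ?scale0r ?add0r //; ring.
Qed.

(** Up to a scalar, the map adds a multiple of [d] to a vector, so it stabilizes
subspaces through [d]; it maps them onto themselves as its square is a nonzero
scalar. *)
Lemma homology_center_line (W : {vspace 'rV[R]_3}) :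
  (<[d]> <= W)%VS -> (f @: W)%VS = W.
Proof.
rewrite -memvE => dW.
have fWW : (f @: W <= W)%VS.
  apply/subvP => _ /memv_imgP[v vW ->].
  by rewrite /f homologyE rpredB // memvZ.
apply/eqP; rewrite eqEsubv fWW /=; apply/subvP => v vW.
have -> : v = f (m ^- 2 *: f v).
  by rewrite homologyZ homology_sq scalerK // expf_neq0.
by apply: memv_img; apply: memvZ; apply: (subvP fWW); apply: memv_img.
Qed.

Lemma homology_involution (v : 'rV[R]_3) :
  (v *m c) 0 0 != 0 -> d \notin <[v]>%VS -> projective_involution f.
Proof.
move=> vc dv; have m20 : m ^+ 2 != 0 by rewrite expf_neq0.
split.
- apply/eqP/lker0P => x y /(congr1 f); rewrite !homology_sq.
  by move=> /(scalerI m20).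
- move=> U _; apply/eqP; rewrite eqEsubv; apply/andP; split; apply/subvP => u.
    move=> /memv_imgP[_ /memv_imgP[x xU ->] ->].
    by rewrite homology_sq memvZ.
  move=> uU; rewrite -[u](scalerK m20) -homology_sq -!homologyZ.
  by do 2!apply: memv_img; rewrite memvZ.
- have v0 : v != 0.
    by apply: contra vc => /eqP ->; rewrite mul0mx mxE.
  exists <[v]>%VS; first by rewrite dim_vline v0.
  rewrite limg_line /f homologyE => fv.
  have : (v *m c) 0 0 *: d - m *: v \in <[v]>%VS by rewrite -fv memv_line.
  rewrite rpredBr; last by rewrite memvZ ?memv_line.
  move=> dV.
  by case/negP: dv; rewrite -[d](scalerK vc); exact: memvZ dV.
Qed.

End Homology.

(** * Convex polygons *)

Section Polygon.
Set Implicit Arguments.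
Unset Strict Implicit.
Context (R : realType) (n : nat) (P : 'Z_(2 * n) -> 'rV[R]_2)
  (mu : 'Z_(2 * n) -> R) (hP : cppos P mu).

Lemma size_gt3 : (3 < 2 * n)%N.
Proof. by rewrite -[4%N]/(2 * 2)%N leq_mul2l (cppos_size hP) orbT. Qed.

Lemma Z2n_nat_neq0 (m : nat) : (0 < m < 2 * n)%N -> (m%:R : 'Z_(2 * n)) != 0.
Proof.
move=> /andP[m0 m2n]; apply/eqP => /(congr1 (fun k : 'Z_(2 * n) => k : nat)).
rewrite val_Zp_nat ?(ltn_trans _ size_gt3) // modn_small // => m00.
by rewrite m00 in m0.
Qed.

Lemma half_turn2 : (n%:R + n%:R : 'Z_(2 * n)) = 0.
Proof.
by rewrite -natrD addnn -mul2n pchar_Zp // (ltn_trans _ size_gt3).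
Qed.

Lemma opp_neq (k : 'Z_(2 * n)) : k + n%:R != k.
Proof.
rewrite -subr_eq0 addrAC subrr add0r Z2n_nat_neq0 //.
by have := cppos_size hP; lia.
Qed.

Lemma opp_neq_succ (k : 'Z_(2 * n)) : k + n%:R != k + 1.
Proof.
rewrite (inj_eq (addrI _)) -subr_eq0 -[1]/(1%:R) -natrB; last exact: ltnW (cppos_size hP).
by rewrite Z2n_nat_neq0 //; have := cppos_size hP; lia.
Qed.

Lemma succ_succ_neq (k : 'Z_(2 * n)) : k + 1 + 1 != k.
Proof.
rewrite -subr_eq0 -(addrA k) addrAC subrr add0r -[1 + 1]/(2%:R).
by rewrite Z2n_nat_neq0 // (ltn_trans _ size_gt3).
Qed.

Lemma succ_neq (k : 'Z_(2 * n)) : k + 1 != k.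
Proof.
rewrite -subr_eq0 addrAC subrr add0r.
by rewrite -[1]/(1%:R) Z2n_nat_neq0 // (ltn_trans _ size_gt3).
Qed.

Lemma edge_det_ge0 (k j : 'Z_(2 * n)) : 0 <= det2 (edge P k) (P j - P k).
Proof.
have [->|jk] := eqVneq j k; first by rewrite /det2 !mxE; lra.
have [->|jk1] := eqVneq j (k + 1); last exact/ltW/(cppos_convex hP).
by rewrite /det2 /edge !mxE; lra.
Qed.

(** Two distinct sides share at most a vertex, so of the two ends of side [k]
one is off the line of side [j]. *)
Lemma open_side_left (k j : 'Z_(2 * n)) (x : 'rV[R]_2) :
  open_side P k x -> j != k -> 0 < det2 (edge P j) (x - P j).
Proof.
move=> [s /= /[!in_itv]/= /andP[s0 s1] <-] jk; rewrite /(edge P k) det2_combo.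
have [kj1|kj1] := eqVneq k (j + 1).
  have := @cppos_convex _ _ _ _ hP j (k + 1).
  rewrite kj1 succ_succ_neq succ_neq => /(_ erefl erefl) gt0.
  by have := edge_det_ge0 j (j + 1); nra.
have := cppos_convex hP _ kj1; rewrite eq_sym jk => /(_ isT) gt0.
by have := edge_det_ge0 j (k + 1); nra.
Qed.

Lemma side_det_ge0 (k j : 'Z_(2 * n)) (x : 'rV[R]_2) :
  side P k x -> 0 <= det2 (edge P j) (x - P j).
Proof.
move=> [s /= /[!in_itv]/= /andP[s0 s1] <-]; rewrite /(edge P k) det2_combo.
by have := edge_det_ge0 j k; have := edge_det_ge0 j (k + 1); nra.
Qed.

Lemma side_det0 (k : 'Z_(2 * n)) (x : 'rV[R]_2) :
  side P k x -> det2 (edge P k) (x - P k) = 0.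
Proof. by move=> [s _ <-]; rewrite /det2 !mxE; ring. Qed.

Lemma open_sideW (k : 'Z_(2 * n)) : open_side P k `<=` side P k.
Proof.
move=> _ [s /= /[!in_itv]/= /andP[s0 s1] <-]; exists s => //=.
by rewrite in_itv /= !ltW.
Qed.

Lemma open_side_side (k j : 'Z_(2 * n)) (x : 'rV[R]_2) :
  open_side P k x -> side P j x -> j = k.
Proof.
move=> xk xj; apply/eqP/contraT => jk.
by have := open_side_left xk jk; rewrite side_det0 // ltxx.
Qed.

Lemma edge_neq0 (k : 'Z_(2 * n)) : edge P k != 0.
Proof. exact: free_not0 (cppos_genuine hP k) (mem_head _ _). Qed.

(** Beyond [y], the line is strictly to the right of side [j], and before [x] of
side [i], where the boundary has no point. Strictly between, a point is to the
left of every side [k], since [x] or [y] is on an open side other than [k]. *)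
Lemma chord_bdry (i j : 'Z_(2 * n)) (x y : 'rV[R]_2) : i != j ->
  open_side P i x -> open_side P j y ->
  line_through x y `&` bdry P = [set x; y].
Proof.
move=> ij xi yj; apply/seteqP; split=> [_ [[w _ <-] [k _ zk]]|_ [->|->]].
- have xj := open_side_left xi; have yi := open_side_left yj.
  have zge0 l := side_det_ge0 l zk.
  have dxi := side_det0 (open_sideW xi); have dyj := side_det0 (open_sideW yj).
  have w1 : w <= 1.
    have := zge0 j; rewrite det2_combo dyj; have := xj j; rewrite eq_sym ij.
    by move=> /(_ isT); nra.
  have w0 : 0 <= w.
    by have := zge0 i; rewrite det2_combo dxi; have := yi i ij; nra.
  have [->|w0'] := eqVneq w 0; first by left; apply: row2P; rewrite !mxE; ring.
  have [->|w1'] := eqVneq w 1; first by right; apply: row2P; rewrite !mxE; ring.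
  have {w0 w0'}w0 : 0 < w by rewrite lt_neqAle eq_sym w0'.
  have {w1 w1'}w1 : w < 1 by rewrite lt_neqAle w1'.
  exfalso; have := side_det0 zk; rewrite det2_combo.
  have [->|ki] := eqVneq k i; first by rewrite dxi; have := yi i ij; nra.
  by have := xj k ki; have := side_det_ge0 k (open_sideW yj); nra.
- split; first by exists 0 => //; rewrite scale0r addr0.
  by exists i => //; apply: open_sideW.
- split; first by exists 1 => //; rewrite scale1r addrC subrK.
  by exists j => //; apply: open_sideW.
Qed.

(** An open side meets no other side, so the description of the point that
defines its image is unique. *)
Lemma sigma_open_side (k : 'Z_(2 * n)) (s : R) : 0 < s < 1 ->
  sigma P (P k + s *: edge P k) = P (k + n%:R) + s *: edge P (k + n%:R).
Proof.
move=> /andP[s0 s1]; apply: get_unique => [|q' [j [t [t01 xt ->]]]].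
  by exists k, s; rewrite !ltW.
have jk : j = k.
  apply: (@open_side_side _ _ (P k + s *: edge P k)).
    by exists s => //=; rewrite in_itv /= s0.
  by exists t => //=; rewrite in_itv /= t01.
rewrite jk in xt *; move/addrI/eqP: xt; rewrite -subr_eq0 -scalerBl scaler_eq0.
by rewrite (negPf (edge_neq0 k)) orbF => /eqP/subr0_eq ->.
Qed.

(** * The strip between two opposite sides *)

Definition height (k : 'Z_(2 * n)) (q : 'rV[R]_2) : R :=
  det2 (edge P k) (q - P k) / det2 (edge P k) (P (k + n%:R) - P k).

Lemma width_gt0 (k : 'Z_(2 * n)) :
  0 < det2 (edge P k) (P (k + n%:R) - P k).
Proof. exact: (cppos_convex hP) (opp_neq k) (opp_neq_succ k). Qed.

Lemma next_vertex (k : 'Z_(2 * n)) : P (k + 1) = P k + edge P k.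
Proof. by rewrite /edge [RHS]addrC subrK. Qed.

Lemma next_opp_vertex (k : 'Z_(2 * n)) :
  P (k + n%:R + 1) = P (k + n%:R) - mu k *: edge P k.
Proof. by rewrite next_vertex (cppos_parallel hP) scaleNr. Qed.

Lemma opp_opp_edge (k : 'Z_(2 * n)) : edge P (k + n%:R + n%:R) = edge P k.
Proof. by rewrite -addrA half_turn2 addr0. Qed.

Lemma height_combo (k : 'Z_(2 * n)) (a b : 'rV[R]_2) (s : R) :
  height k (a + s *: (b - a)) = (1 - s) * height k a + s * height k b.
Proof. by rewrite /height det2_combo mulrDl !mulrA. Qed.

Lemma height_side (k : 'Z_(2 * n)) (s : R) : height k (P k + s *: edge P k) = 0.
Proof. by rewrite /height /det2 !mxE; ring. Qed.

Lemma height_opp_side (k : 'Z_(2 * n)) (s : R) :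
  height k (P (k + n%:R) + s *: edge P k) = 1.
Proof.
have := lt0r_neq0 (width_gt0 k); rewrite /height /det2 !mxE => w0.
by field.
Qed.

Lemma height_is_tau (k : 'Z_(2 * n)) : is_tau P k (height k).
Proof.
split=> [|q [s _ <-]|q [s _ <-]].
- set u := edge P k; set h := det2 u (P (k + n%:R) - P k).
  exists (det2 (h^-1 *: u) : {scalar 'rV[R]_2}), (- det2 u (P k) / h) => q.
  by rewrite /height -/u -/h /= /det2 !mxE; ring.
- exact: height_side.
- rewrite next_opp_vertex.
  rewrite (_ : _ + _ = P (k + n%:R) + (- (s * mu k)) *: edge P k).
    exact: height_opp_side.
  by apply: row2P; rewrite !mxE; ring.
Qed.


(** An affine function is determined by its values at [P k], [P (k + 1)] and
[P (k + n)], which are not collinear. *)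
Lemma tau_is_height (k : 'Z_(2 * n)) (f : 'rV[R]_2 -> R) :
  is_tau P k f -> f = height k.
Proof.
move=> [[g [c fE]] f0 f1]; apply/funext => q.
have /eqP := f0 _ (imageT _ 0); rewrite scale0r addr0 fE addr_eq0 => /eqP gA.
have := f0 _ (imageT _ 1); rewrite scale1r [_ + (_ - _)]addrC subrK fE.
rewrite next_vertex linearD gA /= => /eqP; rewrite addrAC addNr add0r => /eqP ge.
have := f1 _ (imageT _ 0); rewrite scale0r addr0 fE => gB.
have w0 := lt0r_neq0 (width_gt0 k).
rewrite fE {1}(frame_coords _ _ _ (P k) q w0) 2!linearD !linearZ /=.
rewrite [g (P (k + n%:R) - _)]linearB /=.
by rewrite ge gA mulr0 opprK gB -/(height k q); ring.
Qed.

Lemma tauE (k : 'Z_(2 * n)) : tau P k = height k.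
Proof. by apply: get_unique (height_is_tau k) _ => f /tau_is_height. Qed.

(** Relative to [d_k], the point of [d_(k+1)] with parameter [s] is shifted along
the edge by [1 - s (1 + mu k)], because the opposite edge is [mu k] times as
long and reversed; the shift vanishes exactly at [s = lam mu k]. *)
Lemma great_diags_meet (k : 'Z_(2 * n)) :
  great_diag P k `&` great_diag P (k + 1) =
  [set (1 - lam mu k) *: P k + lam mu k *: P (k + n%:R)].
Proof.
have m0 := cppos_mu_gt0 hP k; have m1 : 1 + mu k != 0 by lra.
set D := (1 - _) *: _ + _.
have DE : D = P k + lam mu k *: (P (k + n%:R) - P k).
  by apply: row2P; rewrite !mxE; ring.
have lam01 : 0 <= lam mu k <= 1.
  rewrite /lam ler_pdivlMr ?ler_pdivrMr; lra.
have next s : P (k + 1) + s *: (P (k + 1 + n%:R) - P (k + 1)) =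
    P k + s *: (P (k + n%:R) - P k) + (1 - s * (1 + mu k)) *: edge P k.
  rewrite (addrAC k) next_opp_vertex next_vertex.
  by apply: row2P; rewrite !mxE; ring.
apply/seteqP; split=> [_ [[s _ <-]] [t _]|_ ->].
  rewrite next => st; rewrite /= DE.
  have w0 := width_gt0 k.
  have ts : t = s.
    have := congr1 (height k) st.
    have hE x y : height k (P k + x *: (P (k + n%:R) - P k) + y *: edge P k) = x.
      have := lt0r_neq0 w0; rewrite /height /det2 !mxE => w0'.
      by field.
    by rewrite hE -[X in height k X]addr0 -(scale0r (edge P k)) hE.
  move: st => /eqP; rewrite ts addrC -subr_eq0 addrK scaler_eq0.
  rewrite (negPf (edge_neq0 k)) orbF subr_eq0 => /eqP s1.
  by rewrite (_ : lam mu k = s) // /lam {1}s1 mulfK.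
split; first by exists (lam mu k) => //=; rewrite ?in_itv.
exists (lam mu k) => //=.
by rewrite next DE /lam divfK // subrr scale0r addr0.
Qed.

Lemma DptE (k : 'Z_(2 * n)) :
  Dpt P k = (1 - lam mu k) *: P k + lam mu k *: P (k + n%:R).
Proof. by rewrite /Dpt great_diags_meet; apply: get_unique. Qed.

Lemma region_det_ge0 (k : 'Z_(2 * n)) (q : 'rV[R]_2) :
  region P q -> 0 <= det2 (edge P k) (q - P k).
Proof.
move=> [w [w0 w1 ->]].
rewrite -[P k in X in det2 _ X]scale1r -w1 scaler_suml -sumrB linear_sum /=.
apply: sumr_ge0 => j _; rewrite -scalerBr linearZ /=.
by rewrite mulr_ge0 // edge_det_ge0.
Qed.

(** An interior point stays in the region after a small move towards side [k],
which decreases the determinant. *)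
Lemma interior_det_gt0 (k : 'Z_(2 * n)) (q : 'rV[R]_2) :
  interior (region P) q -> 0 < det2 (edge P k) (q - P k).
Proof.
set v := P (k + n%:R) - P k => qint.
have cvg : q + u *: v @[u --> (0:R)] --> q.
  rewrite -[X in _ --> X]addr0 -(scale0r v).
  by apply: cvgD; [exact: cvg_cst|apply: cvgZr_tmp; exact: cvg_id].
have /nbhs_ballP[r /= r0 ball_r] := cvg _ qint.
have : ball (0 : R) r (- (r / 2)).
  by rewrite /ball /= sub0r opprK gtr0_norm; lra.
move=> /ball_r /= /(region_det_ge0 k).
have shift (c : R) : det2 (edge P k) (q + c *: v - P k) =
    det2 (edge P k) (q - P k) + c * det2 (edge P k) v.
  by rewrite /det2 !mxE; ring.
by rewrite shift; have := width_gt0 k; rewrite -/v; nra.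
Qed.

Lemma tau_interior (k : 'Z_(2 * n)) (q : 'rV[R]_2) :
  interior (region P) q -> 0 < tau P k q < 1.
Proof.
move=> qint; rewrite tauE; have w0 := width_gt0 k.
have := interior_det_gt0 k qint; have := interior_det_gt0 (k + n%:R) qint.
rewrite (cppos_parallel hP) => B0 A0.
rewrite /height ltr_pdivlMr // ltr_pdivrMr // mul0r mul1r A0 /=.
have m0 := cppos_mu_gt0 hP k.
rewrite -(ltr_pM2l m0) -subr_gt0; move: B0; rewrite /det2 !mxE; lra.
Qed.

(** * Reflected lines of the cell *)

Context (i : 'Z_(2 * n)).
Local Notation A := (P i).
Local Notation B := (P (i + n%:R)).
Local Notation e := (edge P i).
Local Notation D := (Dpt P i).
Local Notation m := (mu i).
Local Notation Q := (Qpt P mu i).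

Lemma mu_gt0 : 0 < m.
Proof. exact: cppos_mu_gt0 hP i. Qed.

Lemma height_D : height i D = lam mu i.
Proof.
have -> : D = (A + 0 *: e) + lam mu i *: ((B + 0 *: e) - (A + 0 *: e)).
  by rewrite DptE; apply: row2P; rewrite !mxE; ring.
by rewrite height_combo height_side height_opp_side; ring.
Qed.

(** The homothety of centre [D] and ratio [- m] carries [e_i] onto
[e_(i+n)], hence agrees there with the boundary involution. *)
Lemma sigma_homothety (x : 'rV[R]_2) :
  open_side P i x -> sigma P x = D - m *: (x - D).
Proof.
move=> [s /= /[!in_itv]/= s01 <-]; rewrite sigma_open_side //.
have m1 : 1 + m != 0 by have := mu_gt0; lra.
rewrite (cppos_parallel hP) DptE /lam.
by apply: row2P; rewrite !mxE; field.
Qed.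

Lemma sigma_homothety_inv (y : 'rV[R]_2) :
  open_side P (i + n%:R) y -> sigma P y = D - m^-1 *: (y - D).
Proof.
move=> [s /= /[!in_itv]/= s01 <-]; rewrite sigma_open_side // opp_opp_edge.
have m1 : 1 + m != 0 by have := mu_gt0; lra.
have m0 := lt0r_neq0 mu_gt0.
rewrite (cppos_parallel hP) -(addrA i) half_turn2 addr0 DptE /lam.
by apply: row2P; rewrite !mxE; field; rewrite ?m0 ?m1.
Qed.

Lemma Qpt_den_gt0 (r : R) : 0 <= r <= 1 -> 0 < 1 + (m ^+ 2 - 1) * r.
Proof.
move=> /andP[r0 r1]; have m2 : 0 < m ^+ 2 by rewrite exprn_gt0 // mu_gt0.
have := mulr_ge0 (ltW m2) r0; move: r1; rewrite le_eqVlt => /predU1P[->|]; lra.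
Qed.

Lemma QptE (q : 'rV[R]_2) :
  Q q = D - (m / (1 + (m ^+ 2 - 1) * height i q)) *: (q - D).
Proof. by rewrite /Qpt tauE. Qed.

Lemma height_on_side (x : 'rV[R]_2) : open_side P i x -> height i x = 0.
Proof. by move=> [s _ <-]; exact: height_side. Qed.

Lemma height_on_opp_side (y : 'rV[R]_2) :
  open_side P (i + n%:R) y -> height i y = 1.
Proof.
move=> [s _ <-]; rewrite (cppos_parallel hP) scalerA; exact: height_opp_side.
Qed.

(** Put [x], [y] at weights [1 - r], [r] on the chord. After [sigma] these
endpoints are scaled from [D] by [- m] and [- 1 / m], so the weights [r] and
[1 - r] must be rescaled by [m] and [1 / m] to recover the direction of
[p - D]; the factor multiplying [p - D] depends on [r] alone. *)
Lemma reflected_chord_Q (x y : 'rV[R]_2) (r : R) : 0 <= r <= 1 ->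
  open_side P i x -> open_side P (i + n%:R) y ->
  line_through (sigma P x) (sigma P y) (Q (x + r *: (y - x))).
Proof.
move=> r01 xi yi; rewrite sigma_homothety // sigma_homothety_inv //.
have den0 := lt0r_neq0 (Qpt_den_gt0 r01); have m0 := lt0r_neq0 mu_gt0.
exists (m ^+ 2 * r / (1 + (m ^+ 2 - 1) * r)) => //.
rewrite QptE height_combo height_on_side // height_on_opp_side //.
rewrite mulr0 add0r mulr1.
by apply: row2P; rewrite !mxE; field; rewrite m0 den0.
Qed.

Lemma sigma_chord_neq (x y : 'rV[R]_2) :
  open_side P i x -> open_side P (i + n%:R) y -> sigma P x != sigma P y.
Proof.
move=> [s /= /[!in_itv]/= s01 <-] [t /= /[!in_itv]/= t01 <-].
rewrite !sigma_open_side // opp_opp_edge -(addrA i) half_turn2 addr0.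
rewrite (cppos_parallel hP) scalerA.
apply/eqP => /(congr1 (height i)); rewrite height_side height_opp_side.
by move/eqP; rewrite oner_eq0.
Qed.

Lemma chord_neq (x y : 'rV[R]_2) :
  open_side P i x -> open_side P (i + n%:R) y -> x != y.
Proof.
move=> xi yi; apply/eqP => xy; have := height_on_side xi.
by rewrite xy height_on_opp_side // => /eqP; rewrite oner_eq0.
Qed.

Lemma reflected_chord (x y : 'rV[R]_2) :
  open_side P i x -> open_side P (i + n%:R) y ->
  reflected P (line_through x y) = line_through (sigma P x) (sigma P y).
Proof.
move=> xi yi; have i_opp : i != i + n%:R by rewrite eq_sym opp_neq.
have Lb := chord_bdry i_opp xi yi.
apply/seteqP; split=> [q [x' [y' [x'y' Lb' qL]]]|q qL]; last first.
  by exists x, y; split=> //; exact: chord_neq.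
have : [set x'; y'] x by rewrite -Lb' Lb; left.
have : [set x'; y'] y by rewrite -Lb' Lb; right.
have xy := chord_neq xi yi.
move=> [yE|yE] [xE|xE]; try by rewrite xE yE eqxx in xy.
- by rewrite xE yE line_through_sym.
- by rewrite xE yE.
Qed.

(** The weight of [p] on the chord is its height, as the ends of the chord have
heights 0 and 1. *)
Lemma cellP (p : 'rV[R]_2) (L : set 'rV[R]_2) :
  cell P p i (i + n%:R) L <->
  exists x y : 'rV[R]_2, [/\ open_side P i x, open_side P (i + n%:R) y,
    L = line_through x y & p = x + height i p *: (y - x)].
Proof.
have i_opp : i != i + n%:R by rewrite eq_sym opp_neq.
split=> [[[Lline Lp] [x [y [xy Lb xi yi]]]]|[x [y [xi yi -> pE]]]].
  have Lx : L x by have : [set x; y] x by [left]; rewrite -Lb => -[].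
  have Ly : L y by have : [set x; y] y by [right]; rewrite -Lb => -[].
  have LE := is_line_through _ _ _ _ Lline Lx Ly xy.
  exists x, y; split=> //; move: Lp; rewrite LE => -[r _ <-].
  by rewrite height_combo height_on_side // height_on_opp_side // mulr0 add0r mulr1.
split; first split.
- by exists x, y; split=> //; exact: chord_neq.
- by rewrite pE; exists (height i p).
- by exists x, y; split=> //; [exact: chord_neq|exact: chord_bdry i_opp xi yi].
Qed.

(** * The envelope of the reflected lines *)

Lemma cell_reflected (p : 'rV[R]_2) (L : set 'rV[R]_2) : 0 < height i p < 1 ->
  cell P p i (i + n%:R) L -> is_line (reflected P L) /\ reflected P L (Q p).
Proof.
move=> /andP[p0 p1] /cellP[x [y [xi yi -> pE]]]; rewrite reflected_chord //; split.
  by exists (sigma P x), (sigma P y); split=> //; exact: sigma_chord_neq.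
have r01 : 0 <= height i p <= 1 by rewrite !ltW.
by have := reflected_chord_Q r01 xi yi; rewrite -pE.
Qed.

Lemma height_Q (q : 'rV[R]_2) : 0 <= height i q <= 1 ->
  height i (Q q) = (1 - height i q) / (1 + (m ^+ 2 - 1) * height i q).
Proof.
move=> q01; have den0 := lt0r_neq0 (Qpt_den_gt0 q01).
have m1 : 1 + m != 0 by have := mu_gt0; lra.
rewrite QptE -scaleNr height_combo height_D /lam; field.
by rewrite m1 den0.
Qed.

(** The reflected lines all go through [Q p]: their coordinates annihilate it,
and so do the derivatives of these. *)
Lemma envelope_sub (p : 'rV[R]_2) : 0 < height i p < 1 ->
  art_piece P p i (i + n%:R) `<=` [set proj_pt (Q p)].
Proof.
move=> p01 Z [l [s [near_l ll'0 ->]]] /=.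
have lQ : \forall u \near s, l u *m (hcoords (Q p))^T = 0.
  apply: filterS near_l => u [_ [_ [L cL <-] [_ LE]]].
  by have [_] := cell_reflected p01 cL; rewrite LE.
apply: cross_concurrent => //; first exact: nbhs_singleton lQ.
apply: derive1_mulmx0 lQ.
by have [] := nbhs_singleton near_l.
Qed.

(** Starting from one chord of the cell, rotate it about [p]: when its end on
[e_(i+n)] has parameter [t], the other has parameter [s0 + k (t - t0)], and
both stay in the open interval from 0 to 1 for [t] near [t0]. *)
Lemma cell_family (p : 'rV[R]_2) : 0 < height i p < 1 ->
  cell P p i (i + n%:R) !=set0 ->
  exists t0 : R, \forall t \near t0,
    exists2 L, cell P p i (i + n%:R) L &
      reflected P L = line_through (Q p) (A + t *: e).
Proof.
move=> p01 [L0 /cellP[_ [_ [[s0 /= /[!in_itv]/= s01 <-]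
  [t0 /= /[!in_itv]/= t01 <-] _ pE]]]].
set r := height i p in p01 pE *; move: (p01) => /andP[r0 r1].
exists t0; set k := m * r / (1 - r).
have s_cvg : s0 + k * (t - t0) @[t --> t0] --> s0.
  rewrite -[X in _ --> X]addr0 -(mulr0 k) -(subrr t0).
  apply: cvgD; first exact: cvg_cst.
  by apply: cvgMr; apply: cvgB; [exact: cvg_id|exact: cvg_cst].
move: s01 t01 => /andP[s00 s01] /andP[t00 t01].
near=> t.
have ts : 0 < s0 + k * (t - t0) < 1.
  apply/andP; split; near: t.
  - exact: (cvgr_gt _ s_cvg).
  - exact: (cvgr_lt _ s_cvg).
have t_itv : 0 < t < 1.
  apply/andP; split; near: t; [exact: lt_nbhsr|exact: lt_nbhsl].
set s := s0 + _ in ts.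
set x := A + s *: e; set y := B + t *: edge P (i + n%:R).
have xi : open_side P i x by exists s => //=; rewrite in_itv.
have yi : open_side P (i + n%:R) y by exists t => //=; rewrite in_itv.
have pE' : p = x + r *: (y - x).
  rewrite pE /x /y (cppos_parallel hP) /s /k.
  by apply: row2P; rewrite !mxE; field; lra.
exists (line_through x y); first by apply/cellP; exists x, y.
have sy : sigma P y = A + t *: e.
  by rewrite sigma_open_side // opp_opp_edge -(addrA i) half_turn2 addr0.
have Qon : line_through (sigma P x) (sigma P y) (Q p).
  have r01 : 0 <= r <= 1 by rewrite !ltW.
  by have := reflected_chord_Q r01 xi yi; rewrite -pE'.
rewrite reflected_chord // -sy; apply: is_line_through => //.
- by exists (sigma P x), (sigma P y); split=> //; exact: sigma_chord_neq.
- by exists 1 => //; rewrite scale1r addrC subrK.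
- apply/eqP => /(congr1 (height i)); rewrite sy height_side height_Q ?ltW //.
  move/eqP; rewrite mulf_eq0 invr_eq0 (negPf (lt0r_neq0 (Qpt_den_gt0 _))) ?ltW //.
  by rewrite orbF subr_eq0 eq_sym lt_eqF.
Unshelve. all: by end_near. Qed.

(** The family of reflected lines is parametrized by their trace [A + t e] on
the line of [e_i]: their coordinates are then affine in [t]. *)
Lemma envelope_sup (p : 'rV[R]_2) : 0 < height i p < 1 ->
  cell P p i (i + n%:R) !=set0 ->
  art_piece P p i (i + n%:R) (proj_pt (Q p)).
Proof.
move=> p01 /(cell_family p01)[t0 near_t].
have Q0 : 0 < height i (Q p).
  move: p01 => /andP[p0 p1]; rewrite height_Q ?ltW // divr_gt0 ?subr_gt0 //.
  by rewrite Qpt_den_gt0 ?ltW.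
have Qe : det2 (A - Q p) e != 0.
  rewrite (_ : det2 _ _ = det2 e (Q p - A)); last by rewrite /det2 !mxE; ring.
  by apply: contraTneq Q0; rewrite /height => ->; rewrite mul0r ltxx.
(* The point at infinity of the line of e_i. *)
pose E := hcoords (A + e) - hcoords A.
pose c1 := cross (hcoords (Q p)) E.
pose l : R -> 'rV[R]_3 := fun t => cross (hcoords (Q p)) (hcoords A) + t *: c1.
have lE t : l t = cross (hcoords (Q p)) (hcoords (A + t *: e)).
  by rewrite /l cross_affine -hcoords_affine.
have l' t : is_derive t (1 : R) l c1 := is_derive_affine _ _ _ _ _.
have cE : cross (l t0) (derive1 l t0) = det2 (A - Q p) e *: hcoords (Q p).
  rewrite derive1E derive_val lE.
  rewrite cross_cross; congr (_ *: _).
  rewrite dot3E ![_^T _ _]mxE !crossE /E /det2 !mxE /= ?mxE; ring.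
exists l, t0; split.
- apply: filterS near_t => t [L cL LE]; split; first by have [] := l' t.
  exists (reflected P L); first by exists L.
  have Qt : Q p != A + t *: e.
    by apply: contraTneq Q0 => ->; rewrite height_side ltxx.
  split; last first.
    rewrite LE line_throughE // lE; apply/seteqP; split=> q /=.
      by move=> /eqP; rewrite -cross_incidence => /eqP.
    by move=> /eqP; rewrite cross_incidence => /eqP.
  apply: contra Qe => /eqP l0.
  have := cross_incidence _ (Q p) (A + t *: e) (A + t *: e + e).
  rewrite -lE l0 mul0mx eqxx => /esym/eqP <-.
  by rewrite /det2 !mxE; apply/eqP; ring.
- by rewrite cE scaler_eq0 negb_or Qe hcoords_neq0.
- rewrite cE /proj_pt; apply/eqP; rewrite eqEsubv -!memvE memvZ ?memv_line // andbT.
  by rewrite -{1}[hcoords _](scalerK Qe) memvZ // memv_line.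
Qed.

Lemma art_piece_point (p : 'rV[R]_2) : 0 < height i p < 1 ->
  cell P p i (i + n%:R) !=set0 ->
  art_piece P p i (i + n%:R) = [set proj_pt (Q p)].
Proof.
move=> p01 cell0; apply/seteqP; split; first exact: envelope_sub.
by move=> _ ->; exact: envelope_sup.
Qed.

(** * The projective involution *)

(** In homogeneous coordinates [p |-> Q p] is
[v |-> phi v *: D - m *: v], where [phi] is the linear form taking the value
[(1 + m) (1 + (m - 1) * height i p)] at [hcoords p]. *)
Definition axis_form : 'cV[R]_3 :=
  let h := det2 e (B - A) in
  col3 R ((1 + m) * (m - 1) * - (e 0 1 / h)) ((1 + m) * (m - 1) * (e 0 0 / h))
         ((1 + m) * (1 + (m - 1) * ((e 0 1 * A 0 0 - e 0 0 * A 0 1) / h))).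

Lemma axis_formE (q : 'rV[R]_2) :
  (hcoords q *m axis_form) 0 0 = (1 + m) * (1 + (m - 1) * height i q).
Proof.
rewrite dot_col3 !hcoordsE /height; set h := det2 _ (B - A).
by rewrite /det2 [(q - A) 0 0]mxE [(q - A) 0 1]mxE [(- A) 0 0]mxE [(- A) 0 1]mxE; ring.
Qed.

(** The map is the homology of centre [D] with form [axis_form]; it differs from
the identity at [A], which is off the axis and distinct from the centre. *)
Lemma Q_homology :
  exists f : 'End('rV[R]_3),
    [/\ projective_involution f,
        forall q, 1 + (m ^+ 2 - 1) * height i q != 0 ->
          (f @: proj_pt q)%VS = proj_pt (Q q)
      & forall W : {vspace 'rV[R]_3}, \dim W = 2%N ->
          (proj_pt D <= W)%VS -> (f @: W)%VS = W].
Proof.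
have m0 := mu_gt0; have m0' := lt0r_neq0 m0; have m1 : 1 + m != 0 by lra.
have DD : (hcoords D *m axis_form) 0 0 = m + m.
  by rewrite axis_formE height_D /lam; field.
have A0 : height i A = 0 by have := height_side i 0; rewrite scale0r addr0.
exists (homology _ m axis_form (hcoords D)); split.
- apply: (homology_involution _ _ _ _ m0' DD (hcoords A)).
    by rewrite axis_formE A0 mulr0 addr0 mulr1.
  apply/negP => /vlineP[k DA].
  have D_A := hcoords_scale_inj _ _ _ _ DA.
  have := height_D; rewrite D_A A0 /lam => /esym/eqP.
  by rewrite mulf_eq0 oner_eq0 invr_eq0 (negPf m1).
- move=> q den0; rewrite /proj_pt limg_line homologyE axis_formE.
  set k := 1 + _ in den0.
  rewrite (_ : _ - _ = k *: hcoords (Q q)).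
    apply/eqP; rewrite eqEsubv -!memvE memvZ ?memv_line //=.
    by rewrite -{1}[hcoords _](scalerK den0) memvZ // memv_line.
  have comb (a b : R) (x y : 'rV[R]_3) j : (a *: x - b *: y) 0 j =
      a * x 0 j - b * y 0 j by rewrite !mxE.
  have scal (a : R) (x : 'rV[R]_3) j : (a *: x) 0 j = a * x 0 j by rewrite !mxE.
  have axisE : (1 + m) * (1 + (m - 1) * height i q) = k + m by rewrite /k; ring.
  rewrite axisE QptE -/k; apply: row3P; rewrite comb scal !hcoordsE.
  - by rewrite !mxE; field.
  - by rewrite !mxE; field.
  - by ring.
- by move=> W _; exact: homology_center_line.
Qed.

(** * Position of the centre *)

Lemma center_between (q : 'rV[R]_2) : 0 < height i q < 1 ->
  exists2 t : R, 0 < t < 1 & D = (1 - t) *: q + t *: Q q.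
Proof.
move=> /andP[q0 q1]; rewrite QptE; set c := m / _.
have c0 : 0 < c by rewrite divr_gt0 ?mu_gt0 // Qpt_den_gt0 // !ltW.
have c1 : 1 + c != 0 by lra.
exists (1 / (1 + c)); first by rewrite ltr_pdivlMr ?ltr_pdivrMr; lra.
by apply: row2P; rewrite !mxE; field.
Qed.

Lemma Qpt_lam (q : 'rV[R]_2) : 0 < height i q < 1 ->
  lam mu i ^+ 2 + (1 - 2 * lam mu i) * height i q != 0 /\
  Q q = D - (lam mu i * (1 - lam mu i)
    / (lam mu i ^+ 2 + (1 - 2 * lam mu i) * height i q)) *: (q - D).
Proof.
move=> /andP[q0 q1]; have m0 := mu_gt0; have m1 : 1 + m != 0 by lra.
have den0 : 1 + (m ^+ 2 - 1) * height i q != 0.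
  by rewrite lt0r_neq0 // Qpt_den_gt0 // !ltW.
have denE : lam mu i ^+ 2 + (1 - 2 * lam mu i) * height i q =
    (1 + (m ^+ 2 - 1) * height i q) / (1 + m) ^+ 2.
  by rewrite /lam; field.
rewrite denE; split; first by rewrite mulf_neq0 // invr_eq0 expf_neq0.
rewrite QptE; congr (_ - _ *: _); rewrite /lam; field.
by rewrite m1 den0.
Qed.

End Polygon.

Theorem proposition6p10 (R : realType) (n : nat)
    (P : 'Z_(2 * n) -> 'rV[R]_2) (mu : 'Z_(2 * n) -> R) (hP : cppos P mu)
    (p : 'rV[R]_2) (hp : interior (region P) p)
    (i : 'Z_(2 * n)) (hcell : cell P p i (i + n%:R) !=set0) :
  (great_diag P i `&` great_diag P (i + 1) = [set Dpt P i]
   /\ Dpt P i = (1 - lam mu i) *: P i + lam mu i *: P (i + n%:R))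
  /\ [set f | is_tau P i f] = [set tau P i]
  /\ (forall L, cell P p i (i + n%:R) L ->
        is_line (reflected P L) /\ reflected P L (Qpt P mu i p))
  /\ (forall q : 'rV[R]_2, interior (region P) q ->
        [/\ 1 + (mu i ^+ 2 - 1) * tau P i q != 0,
            lam mu i ^+ 2 + (1 - 2 * lam mu i) * tau P i q != 0
          & Qpt P mu i q =
              Dpt P i
              - (lam mu i * (1 - lam mu i)
                 / (lam mu i ^+ 2 + (1 - 2 * lam mu i) * tau P i q))
                *: (q - Dpt P i)])
  /\ art_piece P p i (i + n%:R) = [set proj_pt (Qpt P mu i p)]
  /\ (exists f : 'End('rV[R]_3),
        [/\ projective_involution f,
            forall q, 1 + (mu i ^+ 2 - 1) * tau P i q != 0 ->
              (f @: proj_pt q)%VS = proj_pt (Qpt P mu i q)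
          & forall W : {vspace 'rV[R]_3}, \dim W = 2%N ->
              (proj_pt (Dpt P i) <= W)%VS -> (f @: W)%VS = W])
  /\ (forall q : 'rV[R]_2, interior (region P) q ->
        exists2 t : R, 0 < t < 1
          & Dpt P i = (1 - t) *: q + t *: Qpt P mu i q).
Proof.
have hint q : interior (region P) q -> 0 < height P i q < 1.
  by move=> qint; rewrite -(tauE hP); exact: (tau_interior hP).
have p01 := hint p hp.
split; first by rewrite (great_diags_meet hP) (DptE hP).
split.
  rewrite (tauE hP); apply/seteqP; split=> [f|_ ->].
  - exact: (tau_is_height hP).
  - exact: (height_is_tau hP).
split; first by move=> L; exact: cell_reflected.
split.
  move=> q /hint q01; have [den0 QE] := Qpt_lam hP q01.
  rewrite (tauE hP); split=> //.
  apply/lt0r_neq0/(Qpt_den_gt0 hP).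
  by move: q01 => /andP[q0 q1]; rewrite !ltW.
split; first exact: art_piece_point.
split; last by move=> q /hint; exact: center_between.
rewrite (tauE hP); exact: Q_homology.
Qed.
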